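(* There exists a universal constant $c>0$ such that the following holds. For any positive $\mu_1,\mu_2,D,\epsilon$ and any deterministic second-order algorithm with initialization point $\mathbf{w}_1$, there exists a function $f:\mathbb{R}^d\to\mathbb{R}$ (for some finite $d$) such that: (i) $f$ is convex, twice-differentiable, has $\mu_1$-Lipschitz gradients and $\mu_2$-Lipschitz Hessians, and has a global minimum $\mathbf{w}^*$ satisfying $\|\mathbf{w}_1-\mathbf{w}^*\|\leq D$; (ii) any index $T$ for which the point $\mathbf{w}_T$ produced by the algorithm on $f$ satisfies $f(\mathbf{w}_T)-f(\mathbf{w}^* )\leq\epsilon$ must satisfy $$T\;\geq\; c\cdot\min\left\{\sqrt{\frac{\mu_1D^2}{\epsilon}}~,~\left(\frac{\mu_2D^3}{\epsilon}\right)^{2/7}\right\}.$$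
   Context: A second-order oracle for $f$, given a point $\mathbf{w}$, returns $f(\mathbf{w})$, $\nabla f(\mathbf{w})$ and $\nabla^2 f(\mathbf{w})$. A deterministic second-order algorithm produces a sequence of points $\mathbf{w}_1,\mathbf{w}_2,\ldots$ in $\mathbb{R}^d$, where each $\mathbf{w}_t$ is a deterministic function of the oracle's responses at $\mathbf{w}_1,\ldots,\mathbf{w}_{t-1}$ (so $\mathbf{w}_1$ is fixed before any oracle call). The dimension $d$ is not fixed in advance and may depend on the other problem parameters; an algorithm is understood to be specified for every dimension $d$. Norms are Euclidean for vectors and spectral for matrices; ''$L$-Lipschitz gradients (Hessians)'' means $\nabla f$ (resp. $\nabla^2 f$) is $L$-Lipschitz with respect to these norms. *)

(* Defs.v *)
From HB Require Import structures.
From mathcomp Require Import all_boot all_order all_algebra.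
From mathcomp Require Import all_classical all_reals all_analysis.

Set Implicit Arguments.
Unset Strict Implicit.
Unset Printing Implicit Defensive.

Import Order.TTheory GRing.Theory Num.Theory.
Import numFieldNormedType.Exports.

Local Open Scope classical_set_scope.
Local Open Scope ring_scope.

(* The library's norm `|v| on row vectors and matrices is the sup norm (it    *)
(* induces the same topology, hence the same notion of differentiability);    *)
(* Lipschitz constants are measured with the two norms below.                 *)

Definition enorm (R : realType) (d : nat) (v : 'rV[R]_d) : R :=
  Num.sqrt (\sum_(j < d) v ord0 j ^+ 2).

(* The operator norm induced by enorm. Matrices act on row vectors from the   *)
(* right. The set is nonempty and bounded, so sup is its supremum.            *)
Definition spectral_norm (R : realType) (d : nat) (M : 'M[R]_d) : R :=
  sup [set enorm (v *m M) | v in [set v : 'rV[R]_d | enorm v <= 1]].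

(* N plays the role of the norm on the codomain.                              *)
Definition lipschitz_with (R : realType) (d : nat) (V : zmodType) (N : V -> R)
    (L : R) (g : 'rV[R]_d -> V) : Prop :=
  forall x y : 'rV[R]_d, N (g x - g y) <= L * enorm (x - y).

Definition gradient (R : realType) (d : nat) (f : 'rV[R]_d -> R)
    (x : 'rV[R]_d) : 'rV[R]_d :=
  \row_(j < d) 'D_(delta_mx ord0 j : 'rV[R]_d) f x.

Definition hessian (R : realType) (d : nat) (f : 'rV[R]_d -> R)
    (x : 'rV[R]_d) : 'M[R]_d :=
  'J (gradient f) x.

Definition twice_differentiable (R : realType) (d : nat)
    (f : 'rV[R]_d -> R) : Prop :=
  (forall x, differentiable f x) /\ (forall x, differentiable (gradient f) x).

Definition oracle_response (R : realType) (d : nat) : Type :=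
  (R * 'rV[R]_d * 'M[R]_d)%type.

Definition second_order_oracle (R : realType) (d : nat) (f : 'rV[R]_d -> R)
    (x : 'rV[R]_d) : oracle_response R d :=
  (f x, gradient f x, hessian f x).

(* A deterministic algorithm in dimension d maps the list of the responses    *)
(* received so far, oldest first, to the next query point.                    *)
Definition algorithm (R : realType) (d : nat) : Type :=
  seq (oracle_response R d) -> 'rV[R]_d.

Definition initial_point (R : realType) (d : nat) (A : algorithm R d) :
  'rV[R]_d := A [::].

Fixpoint responses (R : realType) (d : nat) (A : algorithm R d)
    (f : 'rV[R]_d -> R) (t : nat) : seq (oracle_response R d) :=
  if t is s.+1 then
    rcons (responses A f s) (second_order_oracle f (A (responses A f s)))
  else [::].

(* The t-th point, counted from t = 1, depends on the first t - 1 responses;  *)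
(* the value at t = 0 is meaningless.                                         *)
Definition iterate (R : realType) (d : nat) (A : algorithm R d)
    (f : 'rV[R]_d -> R) (t : nat) : 'rV[R]_d :=
  A (responses A f t.-1).

(* Main.v *)
Require Import Defs.
From HB Require Import structures.
From mathcomp Require Import all_boot all_order all_algebra.
From mathcomp Require Import all_classical all_reals all_analysis.
From mathcomp Require Import ring lra zify.

(** A query reveals the function only in the directions along which it is
    curved, and the hard function is built so that one query uncovers at most
    one new direction. It is

      f(w) = beta * \sum_(i < n) h ((x_i - x_(i+1)) / delta),

    where x_i = <v_i, w - w_1> for i < n, x_n = 0, the v_i are orthonormal,
    and h is convex and nonnegative with h(1) = 0, h(0) = 1, h''(0) = 0.

    If x_i = 0 for all i >= s, then the terms i >= s sit at the argument 0:
    they contribute nothing to the Hessian, and since h'(0) is the same for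
    all of them their gradients telescope to a multiple of v_s. Hence the
    oracle's answer depends only on v_0, ..., v_s ([ridge_oracle_eq]). In high
    dimension the tail of the family can therefore be chosen afterwards,
    orthogonal to every point queried so far, without changing any answer; so
    some family v resists: the s-th query (from s = 0) satisfies x_i = 0 for
    all i >= s ([resisting_family]). At that query the n - s last terms have
    the value beta, while the minimum of f is 0 ([chain_gap]).

    The minimum is reached where all the differences x_i - x_(i+1) are delta,
    at distance at most delta * n^(3/2) from w_1 ([chain_min_dist]); this
    distance is D for delta = D / n^(3/2). The linear map
    w |-> ((x_i - x_(i+1)) / delta)_i has operator norm at most 2 / delta
    (Bessel's inequality, [chain_bessel]), so the gradient and the Hessian of f are
    Lipschitz with constants O(beta / delta^2) and O(beta / delta^3)
    ([gradient_ridge_lipschitz], [hessian_ridge_lipschitz]). With beta of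
    order min(mu1 * delta^2, mu2 * delta^3), the gap after n / 2 queries is
    still of order beta * n, i.e. min(mu1 * D^2 / n^2, mu2 * D^3 / n^(7/2)),
    and this exceeds eps as long as n is at most a constant times
    min(sqrt (mu1 D^2 / eps), (mu2 D^3 / eps)^(2/7)) ([chain_length]).

    One fixed h serves all the parameters, because delta is both the size of
    the differences at the minimum and the scale at which h is evaluated. All
    that is asked of h besides the above is a bounded and Lipschitz second
    derivative; the rational function x^4 / (1 + x^2) - 3 x / 2 + 1 keeps the
    computations algebraic. *)

Set Implicit Arguments.
Unset Strict Implicit.
Unset Printing Implicit Defensive.

Import Order.TTheory GRing.Theory Num.Theory.
Import numFieldNormedType.Exports.

Local Open Scope classical_set_scope.
Local Open Scope ring_scope.

(** * The Euclidean inner product *)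

Section dot.
Context {R : realType} {d : nat}.
Implicit Types u v w : 'rV[R]_d.

Definition dot u v : R := \sum_(j < d) u ord0 j * v ord0 j.

Lemma dotC u v : dot u v = dot v u.
Proof. by apply: eq_bigr => j _; rewrite mulrC. Qed.

Lemma dot_is_linear u : linear (dot u : 'rV[R]_d -> R^o).
Proof.
move=> a v w; rewrite /dot scaler_sumr -big_split; apply: eq_bigr => j _ /=.
by rewrite !mxE mulrDr mulrCA.
Qed.

HB.instance Definition _ u :=
  GRing.isLinear.Build R 'rV[R]_d R^o *:%R (dot u) (dot_is_linear u).

Lemma dotDr u v w : dot u (v + w) = dot u v + dot u w.
Proof. exact: linearD. Qed.

Lemma dotBr u v w : dot u (v - w) = dot u v - dot u w.
Proof. exact: linearB. Qed.

Lemma dotZr a u v : dot u (a *: v) = a * dot u v.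
Proof. exact: linearZ. Qed.

Lemma dot0r u : dot u 0 = 0.
Proof. exact: linear0. Qed.

Lemma dot_sumr I (r : seq I) (P : pred I) (F : I -> 'rV[R]_d) u :
  dot u (\sum_(i <- r | P i) F i) = \sum_(i <- r | P i) dot u (F i).
Proof. exact: linear_sum. Qed.

Lemma dotBl u v w : dot (u - v) w = dot u w - dot v w.
Proof. by rewrite dotC dotBr !(dotC w). Qed.

Lemma dotZl a u v : dot (a *: u) v = a * dot u v.
Proof. by rewrite dotC dotZr dotC. Qed.

Lemma dot0l u : dot 0 u = 0.
Proof. by rewrite dotC dot0r. Qed.

Lemma dot_ge0 u : 0 <= dot u u.
Proof. by apply: sumr_ge0 => j _; rewrite -expr2 sqr_ge0. Qed.

Lemma dot_eq0 u : (dot u u == 0) = (u == 0).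
Proof.
apply/idP/eqP => [|->]; last by rewrite dot0r.
rewrite psumr_eq0 => [/allP u0|j _]; last by rewrite -expr2 sqr_ge0.
apply/rowP => j; have := u0 j (mem_index_enum _).
by rewrite -expr2 sqrf_eq0 mxE => /eqP.
Qed.

Lemma enormE u : enorm u = Num.sqrt (dot u u).
Proof. by congr Num.sqrt; apply: eq_bigr => j _; rewrite expr2. Qed.

Lemma enorm_sqr u : enorm u ^+ 2 = dot u u.
Proof. by rewrite enormE sqr_sqrtr ?dot_ge0. Qed.

Lemma enorm_ge0 u : 0 <= enorm u.
Proof. by rewrite enormE sqrtr_ge0. Qed.

Lemma enorm_le u a : 0 <= a -> dot u u <= a ^+ 2 -> enorm u <= a.
Proof.
by move=> a0 ua; rewrite enormE -[leRHS](ger0_norm a0) -sqrtr_sqr ler_sqrt ?sqr_ge0.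
Qed.

End dot.

Section orthonormal.
Context {R : realType} {d : nat}.
Implicit Types (s : seq 'rV[R]_d) (v : nat -> 'rV[R]_d).

Definition orthonormal_family n v :=
  forall i j, (i < n)%N -> (j < n)%N -> dot (v i) (v j) = (i == j)%:R.

(** Fewer than d linear equations in d unknowns have a nonzero solution. *)
Lemma exists_unit_orthogonal s : (size s < d)%N ->
  exists u : 'rV[R]_d, dot u u = 1 /\ forall a, a \in s -> dot a u = 0.
Proof.
move=> sd; pose A : 'M[R]_(size s, d) := \matrix_(i < size s) nth 0 s i.
have : kermx A^T != 0.
  rewrite -mxrank_eq0 mxrank_ker mxrank_tr subn_eq0 -ltnNge.
  exact: leq_ltn_trans (rank_leq_row A) sd.
case/rowV0Pn => x /sub_kermxP xA x0.
have xx0 : 0 < dot x x by rewrite lt_neqAle dot_ge0 andbT eq_sym dot_eq0.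
exists ((Num.sqrt (dot x x))^-1 *: x); split.
  rewrite dotZl dotZr mulrA -invfM -expr2 sqr_sqrtr ?dot_ge0 //.
  by rewrite mulVf // gt_eqF.
move=> a /(nthP 0)[i si <-]; rewrite dotZr.
have /rowP/(_ (Ordinal si)) := xA; rewrite !mxE => e.
suff -> : dot (nth 0 s i) x = 0 by rewrite mulr0.
by rewrite -[RHS]e /dot; apply: eq_bigr => j _; rewrite !mxE mulrC.
Qed.

Lemma exists_orthonormal_orthogonal s n : (size s + n <= d)%N ->
  exists v, orthonormal_family n v /\ forall i a, (i < n)%N -> a \in s -> dot a (v i) = 0.
Proof.
elim: n => [|n IH] sn; first by exists (fun=> 0); split.
have [|v [vo vs]] := IH; first by apply: leq_trans sn; rewrite leq_add2l.
have [|u [u1 us]] := @exists_unit_orthogonal (s ++ mkseq v n).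
  by rewrite size_cat size_mkseq -addnS.
have uv i : (i < n)%N -> dot (v i) u = 0.
  by move=> ni; apply: us; rewrite mem_cat map_f ?orbT // mem_iota.
exists (fun i => if i == n then u else v i); split.
  move=> i j; rewrite !ltnS (leq_eqVlt i) (leq_eqVlt j).
  case: (eqVneq i n) => [->|ni] /=; case: (eqVneq j n) => [->|nj] //= hi hj.
  - by rewrite dotC uv // eq_sym (negPf nj).
  - by rewrite uv // (negPf ni).
  - exact: vo.
move=> i a; rewrite ltnS leq_eqVlt => hi as_.
case: (eqVneq i n) hi => [_ _|_ /= ni]; last exact: vs.
by apply: us; rewrite mem_cat as_.
Qed.

Lemma bessel n v z : orthonormal_family n v -> \sum_(i < n) dot (v i) z ^+ 2 <= dot z z.
Proof.
move=> vo; pose p := \sum_(i < n) dot (v i) z *: v i.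
have pz : dot p z = \sum_(i < n) dot (v i) z ^+ 2.
  by rewrite dotC dot_sumr; apply: eq_bigr => i _; rewrite dotZr (dotC z) expr2.
have pv (i : 'I_n) : dot p (v i) = dot (v i) z.
  rewrite dotC dot_sumr (bigD1 i) //= big1 ?addr0.
    by rewrite dotZr vo // eqxx mulr1.
  by move=> j ji; rewrite dotZr vo // (inj_eq (@ord_inj _)) eq_sym (negPf ji) mulr0.
have pp : dot p p = \sum_(i < n) dot (v i) z ^+ 2.
  by rewrite {2}/p dot_sumr; apply: eq_bigr => i _; rewrite dotZr pv expr2.
have := dot_ge0 (z - p); rewrite dotBl !dotBr pp pz (dotC z) pz; lra.
Qed.

(** Duality: the synthesis map c |-> \sum c_i b_i is the adjoint of the
    analysis map z |-> (<b_i, z>)_i, hence has the same operator norm. *)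
Lemma frame_synthesis n (b : nat -> 'rV[R]_d) K (c : nat -> R) : 0 < K ->
  (forall z, \sum_(i < n) dot (b i) z ^+ 2 <= K * dot z z) ->
  dot (\sum_(i < n) c i *: b i) (\sum_(i < n) c i *: b i)
    <= K * \sum_(i < n) c i ^+ 2.
Proof.
move=> K0 bK; set z := \sum_(i < n) _.
have : dot z z <= \sum_(i < n) (K / 2 * c i ^+ 2 + (2 * K)^-1 * dot (b i) z ^+ 2).
  rewrite {1}/z dotC dot_sumr; apply: ler_sum => i _.
  rewrite dotZr (dotC z); set t := dot _ _.
  have e : K / 2 * c i ^+ 2 + (2 * K)^-1 * t ^+ 2 - c i * t =
      (2 * K)^-1 * (K * c i - t) ^+ 2 by field; lra.
  by rewrite -subr_ge0 e mulr_ge0 ?sqr_ge0 // invr_ge0; lra.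
rewrite big_split /= -!mulr_sumr => h.
have : (2 * K)^-1 * \sum_(i < n) dot (b i) z ^+ 2 <= dot z z / 2.
  apply: le_trans (_ : (2 * K)^-1 * (K * dot z z) <= _).
    by rewrite ler_pM2l ?bK // invr_gt0; lra.
  by rewrite le_eqVlt; apply/orP; left; apply/eqP; field; lra.
by move: h; set S := \sum_(i < n) c i ^+ 2; nra.
Qed.

End orthonormal.

(** * The scalar profile *)

Section profile.
Context {R : realType}.
Implicit Types x y z : R.

Definition recip x : R := (1 + x ^+ 2)^-1.

(** This is x^4 / (1 + x^2) - 3 x / 2 + 1, in partial fractions. The first term
    has a zero of order 4 at 0, so that an argument 0 contributes nothing to
    the Hessian. *)
Definition profile x : R := x ^+ 2 + recip x - 3 / 2 * x.
(** The first and second derivatives are written as polynomials in the bounded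
    Lipschitz functions 1 / (1 + x^2) and x / (1 + x^2), up to the linear part:
    their Lipschitz constants then follow from [lipschitzM]. *)
Definition profile1 x : R := 2 * x - 2 * (x * recip x * recip x) - 3 / 2.
Definition profile2 x : R :=
  2 + 6 * (x * recip x * (x * recip x) * recip x)
    - 2 * (recip x * recip x * recip x).

Lemma denom_gt0 x : 0 < 1 + x ^+ 2.
Proof. by rewrite ltr_pwDl ?sqr_ge0. Qed.

Lemma denom_neq0 x : 1 + x ^+ 2 != 0.
Proof. by rewrite gt_eqF ?denom_gt0. Qed.

Lemma recipK x : recip x * (1 + x ^+ 2) = 1.
Proof. by rewrite mulVf ?denom_neq0. Qed.

Lemma recip_gt0 x : 0 < recip x.
Proof. by rewrite invr_gt0 denom_gt0. Qed.

Lemma recip_le1 x : recip x <= 1.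
Proof. by rewrite invf_le1 ?denom_gt0 // lerDl sqr_ge0. Qed.

Lemma is_derive_recip x : is_derive x 1 recip (- 2 * x * recip x ^+ 2).
Proof.
have dx : is_derive x 1 (fun y : R => 1 + y ^+ 2) (2 * x).
  rewrite (_ : (fun y => _) = cst 1 + id ^+ 2 :> (R -> R)); last first.
    by apply/funext => y; rewrite !fctE.
  by apply: is_derive_eq; rewrite add0r /GRing.scale /=; ring.
have dr : is_derive x 1 recip (- (1 + x ^+ 2) ^- 2 *: (2 * x)).
  apply: (@is_deriveV R _ x _ _ (denom_neq0 x)); exact: dx.
apply: is_derive_eq dr _.
by rewrite /recip exprVn /GRing.scale /=; ring.
Qed.

Lemma is_derive_profile x : is_derive x 1 profile (profile1 x).
Proof.
have := is_derive_recip x => du.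
rewrite (_ : profile = id ^+ 2 + recip - (3 / 2) *: id :> (R -> R)).
  by apply: is_derive_eq; rewrite /profile1 /GRing.scale /=; ring.
by apply/funext => y; rewrite !fctE.
Qed.

Lemma is_derive_profile1 x : is_derive x 1 profile1 (profile2 x).
Proof.
have := is_derive_recip x => du.
rewrite (_ : profile1 =
    2 *: id - 2 *: (id * recip * recip) - cst (3 / 2) :> (R -> R)).
  apply: is_derive_eq; rewrite /profile2 /GRing.scale /= /recip !fctE; field.
  exact: denom_neq0.
by apply/funext => y; rewrite !fctE.
Qed.

Lemma profile0 : profile 0 = 1.
Proof. by rewrite /profile /recip expr0n /= addr0 invr1; ring. Qed.

Lemma profile2_0 : profile2 0 = 0.
Proof. by rewrite /profile2 /recip expr0n /= addr0 invr1; ring. Qed.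

Lemma profile_1 : profile 1 = 0.
Proof. by rewrite /profile /recip expr1n; field. Qed.

(** The slope 3/2 is the one for which the minimum sits at 1, and it makes
    (x - 1)^2 a factor: (1 + x^2) * profile x = (x - 1)^2 * (x^2 + x / 2 + 1). *)
Lemma profile_ge0 x : 0 <= profile x.
Proof.
have -> : profile x = (x - 1) ^+ 2 * (x ^+ 2 + x / 2 + 1) * recip x.
  by rewrite /profile /recip; field; rewrite denom_neq0.
rewrite mulr_ge0 ?(ltW (recip_gt0 _)) // mulr_ge0 ?sqr_ge0 //.
by have := sqr_ge0 (x + 1 / 4); lra.
Qed.

(** Convexity is proved through its tangents: the gap between the profile and
    a tangent is (x - z)^2 times an explicit nonnegative factor. *)
Lemma profile_tangent x z : profile z + profile1 z * (x - z) <= profile x.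
Proof.
rewrite -subr_ge0.
have -> : profile x - (profile z + profile1 z * (x - z)) =
    (x - z) ^+ 2 * (1 - recip x * recip z ^+ 2 * (1 - z ^+ 2 - 2 * (x * z))).
  by rewrite /profile /profile1 /recip; field; rewrite !denom_neq0.
rewrite mulr_ge0 ?sqr_ge0 // subr_ge0.
have rx := recip_gt0 x; have rz := recip_gt0 z.
have rz2 : recip z ^+ 2 <= 1 by rewrite exprn_ile1 ?recip_le1 // ltW.
apply: le_trans (_ : recip x * recip z ^+ 2 * (1 + x ^+ 2) <= _).
  by rewrite ler_pM2l ?mulr_gt0 ?exprn_gt0 //; have := sqr_ge0 (x + z); lra.
by rewrite mulrAC recipK mul1r.
Qed.

Lemma profile_convex t x y : 0 <= t <= 1 ->
  profile (t * x + (1 - t) * y) <= t * profile x + (1 - t) * profile y.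
Proof.
case/andP=> t0 t1; set z := t * x + _.
have hx := ler_wpM2l t0 (profile_tangent x z).
have t1' : 0 <= 1 - t by lra.
have hy := ler_wpM2l t1' (profile_tangent y z).
have := lerD hx hy; apply: le_trans; rewrite le_eqVlt; apply/orP; left.
by apply/eqP; rewrite /z; ring.
Qed.

Lemma lipschitzM (f g : R -> R) (a b : R) :
    (forall x, `|f x| <= 1) -> (forall x, `|g x| <= 1) ->
    (forall x y, `|f x - f y| <= a * `|x - y|) ->
    (forall x y, `|g x - g y| <= b * `|x - y|) ->
  forall x y, `|f x * g x - f y * g y| <= (a + b) * `|x - y|.
Proof.
move=> f1 g1 fa gb x y.
have -> : f x * g x - f y * g y = (f x - f y) * g x + f y * (g x - g y) by ring.
apply: le_trans (ler_normD _ _) _; rewrite [leRHS]mulrDl !normrM lerD //.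
  by rewrite -[leRHS]mulr1 ler_pM.
by rewrite -[leRHS]mul1r ler_pM.
Qed.

Lemma normM_le1 (a b : R) : `|a| <= 1 -> `|b| <= 1 -> `|a * b| <= 1.
Proof. by move=> *; rewrite normrM mulr_ile1. Qed.

Lemma recip_norm_le1 x : `|recip x| <= 1.
Proof. by rewrite gtr0_norm ?recip_gt0 ?recip_le1. Qed.

Lemma xrecip_norm_le1 x : `|x * recip x| <= 1.
Proof.
have r0 := ltW (recip_gt0 x); have e := recipK x.
have h1 : 0 <= recip x * (1 + x ^+ 2 - x).
  by apply: mulr_ge0 => //; have := sqr_ge0 (x - 1 / 2); lra.
have h2 : 0 <= recip x * (1 + x ^+ 2 + x).
  by apply: mulr_ge0 => //; have := sqr_ge0 (x + 1 / 2); lra.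
by rewrite ler_norml; apply/andP; split; move: h1 h2 e; lra.
Qed.

Lemma recip_lipschitz x y : `|recip x - recip y| <= 2 * `|x - y|.
Proof.
have -> : recip x - recip y =
    - ((x * recip x * recip y + y * recip y * recip x) * (x - y)).
  by rewrite /recip; field; rewrite !denom_neq0.
rewrite normrN normrM ler_wpM2r //; apply: le_trans (ler_normD _ _) _.
by rewrite -[2]/(1 + 1) lerD // normM_le1 // ?recip_norm_le1 ?xrecip_norm_le1.
Qed.

Lemma xrecip_lipschitz x y : `|x * recip x - y * recip y| <= 2 * `|x - y|.
Proof.
have -> : x * recip x - y * recip y =
    (recip x * recip y - x * recip x * (y * recip y)) * (x - y).
  by rewrite /recip; field; rewrite !denom_neq0.
rewrite normrM ler_wpM2r //; apply: le_trans (ler_normB _ _) _.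
by rewrite -[2]/(1 + 1) lerD // normM_le1 // ?recip_norm_le1 ?xrecip_norm_le1.
Qed.

Lemma profile1_lipschitz x y : `|profile1 x - profile1 y| <= 10 * `|x - y|.
Proof.
have := lipschitzM xrecip_norm_le1 recip_norm_le1 xrecip_lipschitz
  recip_lipschitz x y.
have -> : profile1 x - profile1 y = 2 * (x - y) -
  2 * (x * recip x * recip x - y * recip y * recip y) by rewrite /profile1; ring.
move=> h; apply: le_trans (ler_normB _ _) _; rewrite !normrM [`|2|]ger0_norm //.
by move: h; lra.
Qed.

Lemma profile2_lipschitz x y : `|profile2 x - profile2 y| <= 48 * `|x - y|.
Proof.
have pp1 z : `|z * recip z * (z * recip z)| <= 1.
  by rewrite normM_le1 ?xrecip_norm_le1.
have rr1 z : `|recip z * recip z| <= 1 by rewrite normM_le1 ?recip_norm_le1.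
have h1 := lipschitzM pp1 recip_norm_le1
  (lipschitzM xrecip_norm_le1 xrecip_norm_le1 xrecip_lipschitz xrecip_lipschitz)
  recip_lipschitz x y.
have h2 := lipschitzM rr1 recip_norm_le1
  (lipschitzM recip_norm_le1 recip_norm_le1 recip_lipschitz recip_lipschitz)
  recip_lipschitz x y.
have -> : profile2 x - profile2 y =
    6 * (x * recip x * (x * recip x) * recip x -
         y * recip y * (y * recip y) * recip y) -
    2 * (recip x * recip x * recip x - recip y * recip y * recip y).
  by rewrite /profile2; ring.
apply: le_trans (ler_normB _ _) _; rewrite !normrM.
rewrite [`|6|]ger0_norm // [`|2|]ger0_norm //.
by move: h1 h2; lra.
Qed.

End profile.

(** * Sums of ridge functions *)

Section ridge.
Context {R : realType} {d : nat}.
Implicit Types (b c w : 'rV[R]_d) (phi : R -> R).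

Lemma is_diff_dot b w : is_diff w (dot b : 'rV[R]_d -> R) (dot b).
Proof.
have dd x : differentiable (dot b : 'rV[R]_d -> R) x.
  rewrite (_ : dot b = \sum_(j < d) b ord0 j *: (fun y : 'rV[R]_d => y ord0 j : R)).
    by apply: differentiable_sum => j; apply: differentiableZ;
      exact: differentiable_coord.
  by apply/funext => y; rewrite fct_sumE.
apply: DiffDef; first exact: dd.
by rewrite diff_lin // => x; apply: differentiable_continuous.
Qed.

Lemma is_diff_ridge (W : normedModType R) phi phi1 b w0 w (c : W) :
    (forall y : R, is_derive y 1 phi (phi1 y)) ->
  is_diff w (fun z => phi (dot b (z - w0)) *: c)
    (fun h => (phi1 (dot b (w - w0)) * dot b h) *: c).
Proof.
move=> dphi; set y := dot b (w - w0).
have d0 : is_diff w (fun z : 'rV[R]_d => z - w0) id.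
  have := is_diffB (is_diff_id w) (is_diff_cst w0 w); rewrite subr0.
  exact.
have d1 : is_diff w (fun z => dot b (z - w0)) (dot b).
  exact: is_diff_comp d0 (is_diff_dot b (w - w0)).
have d2 : is_diff y phi (fun h => h * phi1 y).
  have [dp pv] := dphi y; apply: DiffDef; first exact/derivable1_diffP.
  by apply/funext => h; rewrite diff1E //; [rewrite derive1E pv | exact/derivable1_diffP].
have d3 := is_diff_comp d1 d2.
have := is_diff_comp d3 (is_diff_scalel (phi y) c).
by move/is_diff_eq; apply; apply/funext => h; rewrite /= mulrC.
Qed.

(** The vector coefficients c_i let the same formula differentiate both the
    function (c_i = 1) and its gradient (c_i = b_i). *)
Lemma is_diff_ridge_sum (W : normedModType R) n phi phi1 (b : nat -> 'rV[R]_d)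
    w0 w (c : nat -> W) :
    (forall y : R, is_derive y 1 phi (phi1 y)) ->
  is_diff w (fun z => \sum_(i < n) phi (dot (b i) (z - w0)) *: c i)
    (fun h => \sum_(i < n) (phi1 (dot (b i) (w - w0)) * dot (b i) h) *: c i).
Proof.
move=> dphi; elim: n => [|n IH].
  rewrite (_ : (fun z => _) = cst 0); last by apply/funext => z; rewrite big_ord0.
  by apply: is_diff_eq; apply/funext => h; rewrite big_ord0.
have := is_diffD IH (is_diff_ridge (b n) w0 w (c n) dphi).
rewrite (_ : _ + _ = fun z => \sum_(i < n.+1) phi (dot (b i) (z - w0)) *: c i).
  by move/is_diff_eq; apply; apply/funext => h; rewrite big_ord_recr.
by apply/funext => z; rewrite big_ord_recr.
Qed.

Variables (phi phi1 phi2 : R -> R) (n : nat) (b : nat -> 'rV[R]_d) (w0 : 'rV[R]_d).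

Definition ridge w : R := \sum_(i < n) phi (dot (b i) (w - w0)).

Hypothesis dphi : forall y : R, is_derive y 1 phi (phi1 y).

Lemma is_diff_ridge1 w : is_diff w ridge
  (fun h => \sum_(i < n) phi1 (dot (b i) (w - w0)) * dot (b i) h).
Proof.
have := is_diff_ridge_sum n b w0 w (fun=> 1 : R^o) dphi.
rewrite (_ : (fun z => _) = ridge).
  move/is_diff_eq; apply; apply/funext => h; apply: eq_bigr => i _.
  by rewrite /GRing.scale /= mulr1.
by apply/funext => h; apply: eq_bigr => i _; rewrite /GRing.scale /= mulr1.
Qed.

Lemma dot_delta w j : dot w (delta_mx ord0 j) = w ord0 j.
Proof.
rewrite /dot (bigD1 j) //= big1 ?addr0 ?mxE ?eqxx ?mulr1 // => k kj.
by rewrite mxE (negPf kj) mulr0.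
Qed.

Lemma gradient_ridge :
  gradient ridge = fun w => \sum_(i < n) phi1 (dot (b i) (w - w0)) *: b i.
Proof.
apply/funext => w; apply/rowP => j; have [dr dv] := is_diff_ridge1 w.
rewrite mxE deriveE // dv summxE; apply: eq_bigr => i _.
by rewrite mxE dot_delta.
Qed.

Hypothesis dphi1 : forall y : R, is_derive y 1 phi1 (phi2 y).

Lemma is_diff_gradient_ridge w : is_diff w (gradient ridge)
  (fun h => \sum_(i < n) (phi2 (dot (b i) (w - w0)) * dot (b i) h) *: b i).
Proof. by rewrite gradient_ridge; exact: is_diff_ridge_sum. Qed.

Lemma twice_differentiable_ridge : twice_differentiable ridge.
Proof.
by split=> w; [case: (is_diff_ridge1 w)|case: (is_diff_gradient_ridge w)].
Qed.

Lemma mul_hessian_ridge w v : v *m hessian ridge w =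
  \sum_(i < n) (phi2 (dot (b i) (w - w0)) * dot (b i) v) *: b i.
Proof.
by rewrite mul_rV_lin1 /=; have [_ ->] := is_diff_gradient_ridge w.
Qed.

Lemma convex_ridge :
    (forall t x y : R, 0 <= t <= 1 ->
      phi (t * x + (1 - t) * y) <= t * phi x + (1 - t) * phi y) ->
  convex_function setT ridge.
Proof.
move=> cphi t x y _ _; rewrite convRE !mulr_sumr -big_split; apply: ler_sum => i _.
apply: le_trans (cphi t%:num _ _ _); last by rewrite ge0 le1.
rewrite le_eqVlt; apply/orP; left; apply/eqP; congr phi.
by rewrite !dotBr dotDr !dotZr /unstable.onem /=; ring.
Qed.

(** The gradient is the synthesis map of [b] applied to phi1 of the analysis
    map, so each of the two maps costs a factor sqrt K. In the Hessian the
    analysis map occurs once more, in the modulus of continuity of phi2. *)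
Variable K : R.
Hypothesis K0 : 0 < K.
Hypothesis bK : forall z, \sum_(i < n) dot (b i) z ^+ 2 <= K * dot z z.

Lemma gradient_ridge_lipschitz L mu : 0 <= L ->
    (forall x y, `|phi1 x - phi1 y| <= L * `|x - y|) -> K * L <= mu ->
  lipschitz_with (@enorm R d) mu (gradient ridge).
Proof.
move=> L0 phiL KL x y; apply: le_trans (_ : K * L * enorm (x - y) <= _); last first.
  by rewrite ler_wpM2r ?enorm_ge0.
apply: enorm_le; first by rewrite !mulr_ge0 ?enorm_ge0 // ltW.
rewrite gradient_ridge -sumrB.
under eq_bigr do rewrite -scalerBl.
pose c i := phi1 (dot (b i) (x - w0)) - phi1 (dot (b i) (y - w0)).
apply: le_trans (frame_synthesis c K0 bK) _.
rewrite exprMn enorm_sqr.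
rewrite [leRHS](_ : _ = K * (L ^+ 2 * (K * dot (x - y) (x - y)))); last by ring.
rewrite ler_pM2l //.
apply: le_trans (_ : \sum_(i < n) L ^+ 2 * dot (b i) (x - y) ^+ 2 <= _).
  apply: ler_sum => i _; rewrite /c -exprMn -[leLHS]real_normK ?num_real //.
  rewrite -[leRHS]real_normK ?num_real // ler_sqr ?nnegrE //.
  apply: le_trans (phiL _ _) _; rewrite normrM (ger0_norm L0) -dotBr.
  by rewrite opprB addrA subrK.
by rewrite -mulr_sumr ler_wpM2l ?sqr_ge0.
Qed.

Lemma dot_le_bound i z : (i < n)%N -> dot (b i) z ^+ 2 <= K * dot z z.
Proof.
move=> ni; apply: le_trans (bK z).
by rewrite (bigD1 (Ordinal ni)) //= lerDl sumr_ge0 // => j _; rewrite sqr_ge0.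
Qed.

Lemma spectral_norm_le (M : 'M[R]_d) a : 0 <= a ->
  (forall v, dot (v *m M) (v *m M) <= a ^+ 2 * dot v v) -> spectral_norm M <= a.
Proof.
move=> a0 h; apply: ge_sup.
  by exists (enorm (0 *m M)), 0 => //=; rewrite enormE dot0r sqrtr0.
move=> _ [v /= v1 <-]; apply: enorm_le => //; apply: le_trans (h v) _.
rewrite ler_piMr ?sqr_ge0 // -enorm_sqr expr_le1 ?enorm_ge0 //.
Qed.

Lemma hessian_ridge_lipschitz L mu : 0 <= L ->
    (forall x y, `|phi2 x - phi2 y| <= L * `|x - y|) ->
    0 <= mu -> K ^+ 3 * L ^+ 2 <= mu ^+ 2 ->
  lipschitz_with (@spectral_norm R d) mu (hessian ridge).
Proof.
move=> L0 phiL mu0 KL x y; apply: spectral_norm_le => [|v].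
  by rewrite mulr_ge0 ?enorm_ge0.
have -> : v *m (hessian ridge x - hessian ridge y) =
    \sum_(i < n) (phi2 (dot (b i) (x - w0)) * dot (b i) v) *: b i -
    \sum_(i < n) (phi2 (dot (b i) (y - w0)) * dot (b i) v) *: b i.
  by rewrite mulmxBr; congr (_ - _); exact: mul_hessian_ridge.
rewrite -sumrB.
under eq_bigr do rewrite -scalerBl -mulrBl.
pose c i := (phi2 (dot (b i) (x - w0)) - phi2 (dot (b i) (y - w0))) * dot (b i) v.
apply: le_trans (frame_synthesis c K0 bK) _.
rewrite exprMn enorm_sqr; set q := dot (x - y) _; have q0 : 0 <= q by exact: dot_ge0.
have vv0 := dot_ge0 v.
apply: le_trans (_ : K ^+ 3 * L ^+ 2 * q * dot v v <= _); last first.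
  by rewrite !ler_wpM2r.
rewrite [leRHS](_ : _ = K * (L ^+ 2 * (K * q) * (K * dot v v))); last by ring.
rewrite ler_pM2l //.
apply: le_trans (_ : \sum_(i < n) L ^+ 2 * (K * q) * dot (b i) v ^+ 2 <= _).
  apply: ler_sum => i _; rewrite /c exprMn ler_wpM2r ?sqr_ge0 //.
  apply: le_trans (_ : L ^+ 2 * dot (b i) (x - y) ^+ 2 <= _).
    rewrite -exprMn -[leLHS]real_normK ?num_real //.
    rewrite -[leRHS]real_normK ?num_real // ler_sqr ?nnegrE //.
    apply: le_trans (phiL _ _) _; rewrite normrM (ger0_norm L0) -dotBr.
    by rewrite opprB addrA subrK.
  by rewrite ler_wpM2l ?sqr_ge0 // dot_le_bound.
by rewrite -mulr_sumr ler_wpM2l ?bK // !mulr_ge0 ?sqr_ge0 // ltW.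
Qed.

End ridge.

(** * Resisting chains *)

Section oracle.
Context {R : realType} {d : nat}.
Variables (phi phi1 phi2 : R -> R).
Hypothesis dphi : forall y : R, is_derive y 1 phi (phi1 y).
Hypothesis dphi1 : forall y : R, is_derive y 1 phi1 (phi2 y).
Hypothesis phi2_0 : phi2 0 = 0.

(** Terms whose argument is 0 are invisible to the oracle up to the common
    first-order part phi1 0 *: \sum_i b i; hence only the latter has to agree
    for the families b and b', together with the visible directions. *)
Lemma ridge_oracle_eq n (b b' : nat -> 'rV[R]_d) w0 w :
    \sum_(i < n) b i = \sum_(i < n) b' i ->
    (forall i, (i < n)%N -> b i = b' i \/
       dot (b i) (w - w0) = 0 /\ dot (b' i) (w - w0) = 0) ->
  second_order_oracle (ridge phi n b w0) w =
  second_order_oracle (ridge phi n b' w0) w.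
Proof.
move=> sb bb'.
have ef : ridge phi n b w0 w = ridge phi n b' w0 w.
  by apply: eq_bigr => i _; have [->//|[-> ->]] := bb' i (ltn_ord i).
have eg : gradient (ridge phi n b w0) w = gradient (ridge phi n b' w0) w.
  have E c : gradient (ridge phi n c w0) w =
      \sum_(i < n) (phi1 (dot (c i) (w - w0)) - phi1 0) *: c i +
      phi1 0 *: \sum_(i < n) c i.
    rewrite (gradient_ridge _ _ _ dphi) scaler_sumr -big_split.
    by apply: eq_bigr => i _; rewrite /= -scalerDl subrK.
  rewrite !E sb; congr (_ + _); apply: eq_bigr => i _.
  by have [->//|[-> ->]] := bb' i (ltn_ord i); rewrite subrr !scale0r.
have eh : hessian (ridge phi n b w0) w = hessian (ridge phi n b' w0) w.
  apply/row_matrixP => k.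
  apply: etrans (rowE _ _) (etrans _ (esym (rowE _ _))).
  apply: etrans (mul_hessian_ridge n b w0 dphi dphi1 w _) _.
  apply: etrans _ (esym (mul_hessian_ridge n b' w0 dphi dphi1 w _)).
  apply: eq_bigr => i _.
  by have [->//|[-> ->]] := bb' i (ltn_ord i); rewrite phi2_0 !mul0r !scale0r.
exact: (f_equal2 pair (f_equal2 pair ef eg) eh).
Qed.

End oracle.

Section chain.
Context {R : realType} {d : nat}.
Variables (delta : R) (n : nat).
Hypothesis delta0 : 0 < delta.
Implicit Types (v : nat -> 'rV[R]_d) (w z : 'rV[R]_d).

(** The gradient of w |-> (x_i - x_(i+1)) / delta, with x_i = <v_i, w>. *)
Definition chain v i : 'rV[R]_d := delta^-1 *: (v i - v i.+1).

(** Padding with zeros makes the last difference x_(n-1) - 0 an instance of the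
    general x_i - x_(i+1). *)
Definition padded_orthonormal v := orthonormal_family n v /\ forall i, (n <= i)%N -> v i = 0.

Lemma dot_chain v i z : dot (chain v i) z = delta^-1 * (dot (v i) z - dot (v i.+1) z).
Proof. by rewrite /chain dotZl dotBl. Qed.

Lemma sum_chain v : padded_orthonormal v -> \sum_(i < n) chain v i = delta^-1 *: v 0.
Proof.
move=> [_ v0]; rewrite /chain -scaler_sumr -(big_mkord xpredT (fun i => v i - v i.+1)).
congr (_ *: _); rewrite -[LHS]opprK -sumrN.
under eq_bigr do rewrite opprB.
by rewrite telescope_sumr // v0 // sub0r opprK.
Qed.

(** Bessel's inequality and (x - y)^2 <= 2 x^2 + 2 y^2: the family counts twice,
    once for each end of the differences. *)
Lemma chain_bessel v z : padded_orthonormal v ->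
  \sum_(i < n) dot (chain v i) z ^+ 2 <= 4 / delta ^+ 2 * dot z z.
Proof.
move=> [vo v0]; set S := \sum_(i < n) dot (v i) z ^+ 2.
have S1 : \sum_(i < n) dot (v i.+1) z ^+ 2 <= S.
  have : \sum_(i < n.+1) dot (v i) z ^+ 2 = S.
    by rewrite big_ord_recr /= v0 // dot0l expr0n addr0.
  by rewrite big_ord_recl => <-; rewrite lerDr sqr_ge0.
have SB : S <= dot z z by exact: bessel.
have d2 : 0 <= delta ^- 2 by rewrite invr_ge0 sqr_ge0.
apply: le_trans (_ : \sum_(i < n) delta ^- 2 *
    (2 * dot (v i) z ^+ 2 + 2 * dot (v i.+1) z ^+ 2) <= _).
  apply: ler_sum => i _; rewrite dot_chain exprMn exprVn ler_wpM2l //.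
  by have := sqr_ge0 (dot (v i) z + dot (v i.+1) z); lra.
rewrite -mulr_sumr big_split /= -!mulr_sumr (mulrC 4) -mulrA ler_wpM2l //.
by move: S1 SB; rewrite -/S; lra.
Qed.

Lemma dot_chain_eq0 v w s i : (forall i, (s <= i)%N -> dot (v i) w = 0) ->
  (s <= i)%N -> dot (chain v i) w = 0.
Proof. by move=> v0 si; rewrite dot_chain !v0 ?subrr ?mulr0 // leqW. Qed.

(** The coordinates of the minimizer decrease linearly to 0, so that all the
    consecutive differences equal delta, where the profile is minimal. *)
Definition chain_min v w0 : 'rV[R]_d :=
  w0 + \sum_(i < n) (delta * (n - i)%:R) *: v i.

Lemma dot_chain_min v w0 j : padded_orthonormal v -> (j <= n)%N ->
  dot (v j) (chain_min v w0 - w0) = delta * (n - j)%:R.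
Proof.
move=> [vo v0]; rewrite leq_eqVlt => /orP[/eqP ->|jn].
  by rewrite v0 // dot0l subnn mulr0.
rewrite /chain_min addrC addKr dot_sumr (bigD1 (Ordinal jn)) //= big1 ?addr0.
  by rewrite dotZr vo // eqxx mulr1.
move=> i ij; rewrite dotZr vo // (_ : _ == _ = false) ?mulr0 //.
by apply/negbTE; apply: contra ij => /eqP e; apply/eqP/val_inj.
Qed.

Lemma dot_chain_chain_min v w0 i : padded_orthonormal v -> (i < n)%N ->
  dot (chain v i) (chain_min v w0 - w0) = 1.
Proof.
move=> fv ni; rewrite dot_chain !dot_chain_min // ?(ltnW ni) //.
by rewrite -(subnSK ni) -natr1 (mulrDr delta) mulr1 addrAC subrr add0r mulVf ?gt_eqF.
Qed.

Lemma chain_min_dist v w0 : padded_orthonormal v ->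
  dot (w0 - chain_min v w0) (w0 - chain_min v w0) <= delta ^+ 2 * n%:R ^+ 3.
Proof.
move=> fv; rewrite -[w0 - _]opprB -scaleN1r dotZl dotZr mulrA mulN1r opprK mul1r.
have e : chain_min v w0 - w0 = \sum_(i < n) (delta * (n - i)%:R) *: v i.
  by rewrite /chain_min addrC addKr.
rewrite {2}e dot_sumr.
apply: le_trans (_ : \sum_(i < n) delta ^+ 2 * n%:R ^+ 2 <= _).
  apply: ler_sum => i _; rewrite dotZr dotC dot_chain_min ?(ltnW (ltn_ord i)) //.
  rewrite -expr2 exprMn ler_wpM2l ?sqr_ge0 // ler_sqr ?nnegrE //.
  by rewrite ler_nat leq_subr.
by rewrite sumr_const card_ord -mulr_natr le_eqVlt; apply/orP; left; apply/eqP; ring.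
Qed.

End chain.

Section resisting.
Context {R : realType} {d : nat}.
Variables (phi phi1 phi2 : R -> R).
Hypothesis dphi : forall y : R, is_derive y 1 phi (phi1 y).
Hypothesis dphi1 : forall y : R, is_derive y 1 phi1 (phi2 y).
Hypothesis phi2_0 : phi2 0 = 0.
Variables (delta : R) (n : nat) (A : algorithm R d).

Let w0 := initial_point A.
Let F v := ridge phi n (chain delta v) w0.
Let query v s := A (responses A (F v) s).

Lemma responses_eq (f g : 'rV[R]_d -> R) k :
  (forall s, (s < k)%N -> second_order_oracle f (A (responses A f s)) =
                         second_order_oracle g (A (responses A f s))) ->
  responses A f k = responses A g k.
Proof.
elim: k => [//|k IH] fg /=.
have e : responses A f k = responses A g k by apply: IH => s sk; apply: fg; exact: ltnW.
by rewrite -e fg.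
Qed.

(** By induction on k: the vectors v_i with i >= k are replaced by fresh ones,
    orthogonal to the first k + 1 queries (and to the vectors kept). The first
    k answers, hence the first k + 1 queries, do not notice the replacement,
    as the answer to query s only involves v_0, ..., v_s. The dimension has to
    leave room for n vectors orthogonal to fewer than 2 n others. *)
Lemma resisting_family k : (k <= n)%N -> (3 * n <= d)%N ->
  exists v, padded_orthonormal n v /\
    forall s i, (s < k)%N -> (s <= i)%N -> dot (v i) (query v s - w0) = 0.
Proof.
move=> kn nd; elim: k kn => [_|k IH kn].
  have [|v [vo _]] := @exists_orthonormal_orthogonal R d [::] n.
    by rewrite add0n; apply: leq_trans nd; rewrite leq_pmull.
  exists (fun i => if (i < n)%N then v i else 0); split=> //; split.
    by move=> i j ni nj; rewrite ni nj vo.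
  by move=> i; rewrite leqNgt => /negbTE ->.
have [v [[vo v0] vq]] := IH (ltnW kn).
pose s0 := mkseq v k ++ mkseq (fun s => query v s - w0) k.+1.
have [|u [uo us]] := @exists_orthonormal_orthogonal R d s0 (n - k).
  rewrite size_cat !size_mkseq; lia.
pose v' i := if (i < k)%N then v i else if (i < n)%N then u (i - k)%N else 0.
have uv i j : (i < k)%N -> (k <= j < n)%N -> dot (v i) (u (j - k)%N) = 0.
  move=> ik jk; apply: us; first lia.
  by rewrite mem_cat; apply/orP; left; apply/map_f; rewrite mem_iota.
have fv' : padded_orthonormal n v'.
  split=> [i j ni nj|i ni]; last by rewrite /v' !ltnNge ni (leq_trans _ ni) // ltnW.
  rewrite /v' ni nj; case: (ltnP i k) => ik; case: (ltnP j k) => jk.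
  - exact: vo.
  - by rewrite uv ?jk //; case: eqP => // e; lia.
  - by rewrite dotC uv ?ik //; case: eqP => // e; lia.
  - rewrite uo; [|lia|lia]; case: (eqVneq i j) => [->|ij]; first by rewrite eqxx.
    by case: eqP => // e; lia.
have v'q s i : (s <= k)%N -> (s <= i)%N -> dot (v' i) (query v s - w0) = 0.
  move=> sk si; rewrite /v'; case: ltnP => ik.
    by apply: vq => //; exact: leq_ltn_trans ik.
  case: ltnP => ni; last by rewrite dot0l.
  rewrite dotC us //; first lia.
  by rewrite mem_cat; apply/orP; right; apply/mapP; exists s; rewrite ?mem_iota.
have e s : (s <= k)%N -> query v' s = query v s.
  move=> sk; congr (A _); apply/esym/responses_eq => r rs.
  apply: (ridge_oracle_eq dphi dphi1 phi2_0).
    rewrite !sum_chain // /v' (leq_ltn_trans _ (leq_trans rs sk)) //.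
  move=> i ni; case: (ltnP i r) => ir.
    by left; rewrite /chain /v' !ifT //; lia.
  right; split; apply: dot_chain_eq0 ir => j rj.
    by apply: vq => //; lia.
  by apply: v'q => //; lia.
by exists v'; split => // s i; rewrite ltnS => sk si; rewrite e // v'q.
Qed.

Lemma chain_gap v s : (forall y, 0 <= phi y) -> (s <= n)%N ->
    (forall i, (s <= i)%N -> dot (v i) (query v s - w0) = 0) ->
  phi 0 * (n - s)%:R <= F v (query v s).
Proof.
move=> pge sn v0.
pose G i := phi (dot (chain delta v i) (query v s - w0)).
have -> : F v (query v s) = \sum_(0 <= i < n) G i by rewrite big_mkord.
rewrite (big_cat_nat (n := s)) //=.
have -> : \sum_(s <= i < n) G i = phi 0 * (n - s)%:R.
  rewrite mulr_natr -sumr_const_nat; apply: eq_big_nat => i /andP[si _].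
  by rewrite /G (dot_chain_eq0 _ v0).
by rewrite lerDr; apply: sumr_ge0 => i _; exact: pge.
Qed.

End resisting.

(** * Choice of the parameters *)

Lemma is_derive_scale (R : realType) (phi phi1 : R -> R) (a : R) :
  (forall y : R, is_derive y 1 phi (phi1 y)) ->
  forall y : R, is_derive y 1 (fun x => a * phi x) (a * phi1 y).
Proof. by move=> dphi y; exact: (is_deriveZ a (dphi y)). Qed.

Lemma lipschitz_scale (R : realType) (phi : R -> R) (a L : R) : 0 <= a ->
  (forall x y, `|phi x - phi y| <= L * `|x - y|) ->
  forall x y, `|a * phi x - a * phi y| <= a * L * `|x - y|.
Proof.
by move=> a0 h x y; rewrite -mulrBr normrM (ger0_norm a0) -mulrA ler_wpM2l.
Qed.

Lemma slack_of_lt_quarter (n T : nat) : (1 <= T)%N -> (4 * T < n)%N ->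
  (T.-1 < n)%N /\ (n < 2 * (n - T.-1))%N.
Proof. by move=> T1 Tn; split; lia. Qed.

(** The length n is of order M / 20, where M is the minimum of the two
    rates, and delta = D / n^(3/2) puts the minimizer at distance D. The
    constants 40 = 4 * 10 and 384 = 8 * 48 in beta come from the operator norm
    2 / delta of the chain and the Lipschitz constants 10 and 48 of the
    derivatives of the profile. A query T < M / 80 satisfies 4 * T < n, so it
    leaves more than n / 2 terms of the chain untouched. *)
Lemma chain_length (R : realType) (mu1 mu2 D eps : R) :
    0 < mu1 -> 0 < mu2 -> 0 < D -> 0 < eps ->
  exists (n : nat) (delta beta : R), [/\ (0 < n)%N, 0 < delta, 0 < beta &
    [/\ delta ^+ 2 * n%:R ^+ 3 = D ^+ 2,
        4 / delta ^+ 2 * (beta * 10) <= mu1,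
        (4 / delta ^+ 2) ^+ 3 * (beta * 48) ^+ 2 <= mu2 ^+ 2 &
        forall T : nat, (1 <= T)%N ->
          T%:R < 1 / 80 * Num.min (Num.sqrt (mu1 * D ^+ 2 / eps))
                                  ((mu2 * D ^+ 3 / eps) `^ (2 / 7)) ->
          (T.-1 < n)%N /\ eps < beta * (n - T.-1)%:R]].
Proof.
move=> mu1_0 mu2_0 D0 eps0.
set a := Num.sqrt _; set q := _ `^ _; set M := Num.min a q.
have a0 : 0 < a by rewrite sqrtr_gt0 divr_gt0 ?mulr_gt0 ?exprn_gt0.
have P0 : 0 < mu2 * D ^+ 3 / eps by rewrite divr_gt0 ?mulr_gt0 ?exprn_gt0.
have q0 : 0 < q by rewrite powR_gt0.
have M0 : 0 < M by rewrite lt_min a0 q0.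
have [n /andP[Mn nM1]] : exists n : nat, M / 20 < n%:R <= M / 20 + 1.
  exists (Num.truncn (M / 20)).+1.
  have /andP[h1 h2] : (Num.truncn (M / 20))%:R <= M / 20 < (Num.truncn (M / 20)).+1%:R.
    by apply: truncn_itv; rewrite divr_ge0 // ltW.
  by rewrite h2 -natr1 lerD2r.
have n0 : 0 < n%:R :> R by apply: lt_trans Mn; rewrite divr_gt0.
pose r := Num.sqrt (n%:R : R).
have r0 : 0 < r by rewrite sqrtr_gt0.
have rn : r ^+ 2 = n%:R by rewrite sqr_sqrtr // ltW.
pose delta := D / r ^+ 3.
have de0 : 0 < delta by rewrite divr_gt0 ?exprn_gt0.
have rD : r ^+ 3 * delta = D by rewrite mulrC divfK // gt_eqF ?exprn_gt0.
pose b1 := mu1 * delta ^+ 2 / 40; pose b2 := mu2 * delta ^+ 3 / 384.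
pose beta := Num.min b1 b2.
have be0 : 0 < beta.
  have d2 : 0 < mu1 * delta ^+ 2 by rewrite mulr_gt0 ?exprn_gt0.
  have d3 : 0 < mu2 * delta ^+ 3 by rewrite mulr_gt0 ?exprn_gt0.
  by rewrite lt_min /b1 /b2; apply/andP; split; lra.
exists n, delta, beta; split=> //; first by rewrite -(ltr_nat R).
split.
- by rewrite -rn -rD; ring.
- have : beta <= b1 by rewrite ge_min lexx.
  rewrite /b1 => h.
  have -> : 4 / delta ^+ 2 * (beta * 10) = beta * 40 / delta ^+ 2 by ring.
  by rewrite ler_pdivrMr ?exprn_gt0 //; lra.
- have : beta <= b2 by rewrite ge_min lexx orbT.
  rewrite /b2 => h.
  have -> : (4 / delta ^+ 2) ^+ 3 * (beta * 48) ^+ 2 = (384 * beta / delta ^+ 3) ^+ 2.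
    by field; rewrite gt_eqF.
  apply: lerXn2r; rewrite ?nnegrE; [|exact: ltW|].
    apply: divr_ge0; last by rewrite exprn_ge0 // ltW.
    by apply: mulr_ge0; [exact: ler0n | exact: ltW].
  by rewrite ler_pdivrMr ?exprn_gt0 //; lra.
move=> T T1 TM.
have T1' : 1 <= T%:R :> R by rewrite ler1n.
have nM10 : n%:R <= M / 10 by lra.
have nT : 4 * T%:R < n%:R :> R by lra.
have nT' : (4 * T < n)%N by rewrite -(ltr_nat R) natrM.
have [sn sn2] := slack_of_lt_quarter T1 nT'.
split=> //.
have half : n%:R / 2 < (n - T.-1)%:R :> R.
  by rewrite -(ltr_nat R) natrM in sn2; lra.
suff : eps <= beta * (n%:R / 2) by move/le_lt_trans; apply; rewrite ltr_pM2l.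
rewrite -ler_pdivrMr; last by rewrite divr_gt0.
rewrite le_min; apply/andP; split; rewrite ler_pdivrMr ?divr_gt0 // -rn.
- have na : n%:R <= a / 10.
    by apply: le_trans nM10 _; rewrite ler_pM2r // ge_min lexx.
  have : n%:R ^+ 2 <= (a / 10) ^+ 2 by rewrite ler_sqr ?nnegrE ?divr_ge0 // ltW.
  rewrite exprMn sqr_sqrtr; last by rewrite ltW // divr_gt0 ?mulr_gt0 ?exprn_gt0.
  rewrite -rn => h.
  have h2 : r ^+ 4 * eps * 100 <= mu1 * D ^+ 2.
    rewrite -ler_pdivlMr // -ler_pdivlMr // ; apply: le_trans (_ : (r ^+ 2) ^+ 2 <= _).
      by rewrite -exprM.
    by apply: le_trans h _; rewrite le_eqVlt; apply/orP; left; apply/eqP; field; rewrite gt_eqF.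
  have h3 : eps * 100 <= mu1 * (r * delta) ^+ 2.
    have r4 : 0 < r ^+ 4 by rewrite exprn_gt0.
    rewrite -(ler_pM2l r4); apply: le_trans (_ : r ^+ 4 * eps * 100 <= _); first by rewrite mulrA.
    by apply: le_trans h2 _; rewrite -rD le_eqVlt; apply/orP; left; apply/eqP; ring.
  apply: le_trans (_ : mu1 * (r * delta) ^+ 2 / 80 <= _); first lra.
  by rewrite /b1 le_eqVlt; apply/orP; left; apply/eqP; field.
- have nq : n%:R <= q / 10.
    by apply: le_trans nM10 _; rewrite ler_pM2r // ge_min lexx orbT.
  have q7 : q ^+ 7 = (mu2 * D ^+ 3 / eps) ^+ 2.
    rewrite -powR_mulrn ?ltW // -powRrM divfK // powR_mulrn //; exact: ltW.
  have : n%:R ^+ 7 <= (q / 10) ^+ 7 by rewrite lerXn2r ?nnegrE ?divr_ge0 // ltW.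
  rewrite exprMn q7 -rn -exprM => h.
  (* The constant 10 ^ 7 is rounded down to the square 10 ^ 6 *)
  have h1 : r ^+ 7 <= mu2 * D ^+ 3 / eps * 10^-1 ^+ 3.
    have ? : 0 <= mu2 * D ^+ 3 / eps * 10^-1 ^+ 3 by rewrite mulr_ge0 // ltW.
    rewrite -ler_sqr ?nnegrE ?exprn_ge0 ?(ltW r0) //.
    rewrite -exprM; apply: le_trans h _; rewrite [leRHS]exprMn ler_wpM2l ?sqr_ge0 //.
    by rewrite -exprM ler_wiXn2l ?invr_ge0 // invf_le1 // ler1n.
  have h2 : r ^+ 7 * eps <= mu2 * D ^+ 3 * 10^-1 ^+ 3.
    by rewrite -ler_pdivlMr // mulrAC.
  have h3 : eps <= mu2 * (r ^+ 2 * delta ^+ 3) * 10^-1 ^+ 3.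
    have r7 : 0 < r ^+ 7 by rewrite exprn_gt0.
    rewrite -(ler_pM2l r7); apply: le_trans h2 _.
    by rewrite -rD le_eqVlt; apply/orP; left; apply/eqP; ring.
  have e : 10^-1 ^+ 3 = 1 / 1000 :> R by field.
  have : 0 < mu2 * (r ^+ 2 * delta ^+ 3).
    by rewrite mulr_gt0 // mulr_gt0 ?exprn_gt0.
  by move: h3; rewrite e /b2; lra.
Qed.

Theorem theorem2 (R : realType) :
  exists2 c : R, 0 < c &
  forall (mu1 mu2 D eps : R), 0 < mu1 -> 0 < mu2 -> 0 < D -> 0 < eps ->
  forall A : (forall d : nat, algorithm R d),
  exists (d : nat) (f : 'rV[R]_d -> R) (wstar : 'rV[R]_d),
    [/\ (0 < d)%N,
        [/\ convex_function setT f,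
            twice_differentiable f,
            lipschitz_with (@enorm R d) mu1 (gradient f) &
            lipschitz_with (@spectral_norm R d) mu2 (hessian f)],
        (forall w : 'rV[R]_d, f wstar <= f w),
        enorm (initial_point (A d) - wstar) <= D &
        forall T : nat, (1 <= T)%N ->
          f (iterate (A d) f T) - f wstar <= eps ->
          c * Num.min (Num.sqrt (mu1 * D ^+ 2 / eps))
                      ((mu2 * D ^+ 3 / eps) `^ (2 / 7)) <= T%:R].
Proof.
exists (1 / 80); first by rewrite divr_gt0.
move=> mu1 mu2 D eps mu1_0 mu2_0 D0 eps0 A.
have [n [delta [beta [n0 de0 be0 [nD hmu1 hmu2 hT]]]]] :=
  chain_length mu1_0 mu2_0 D0 eps0.
pose phi (x : R) := beta * profile x.
have dphi := is_derive_scale beta (@is_derive_profile R).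
have dphi1 := is_derive_scale beta (@is_derive_profile1 R).
have phi2_0 : beta * profile2 0 = 0 :> R by rewrite profile2_0 mulr0.
have phi_ge0 x : 0 <= phi x by rewrite mulr_ge0 ?profile_ge0 // ltW.
have phi0 : phi 0 = beta by rewrite /phi profile0 mulr1.
have [v [fv vq]] := resisting_family dphi dphi1 phi2_0 delta (A (3 * n)%N)
  (leqnn n) (leqnn _).
set w0 := initial_point (A (3 * n)%N) in vq *.
have K0 : 0 < 4 / delta ^+ 2 by rewrite divr_gt0 ?exprn_gt0.
have fK z := chain_bessel delta z fv.
have be0' := ltW be0.
have fmin : ridge phi n (chain delta v) w0 (chain_min delta n v w0) = 0.
  apply: big1 => i _; rewrite dot_chain_chain_min //.
  by rewrite /phi profile_1 mulr0.
exists (3 * n)%N, (ridge phi n (chain delta v) w0), (chain_min delta n v w0).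
split; first by rewrite muln_gt0.
- split.
  + apply: convex_ridge => t x y t01; rewrite /phi !(mulrCA _ beta) -mulrDr.
    by rewrite ler_pM2l // profile_convex.
  + exact: twice_differentiable_ridge dphi dphi1.
  + apply: (gradient_ridge_lipschitz w0 dphi K0 fK _ _ hmu1).
      by rewrite mulr_ge0.
    exact: lipschitz_scale be0' (@profile1_lipschitz R).
  + apply: (hessian_ridge_lipschitz w0 dphi dphi1 K0 fK _ _ _ hmu2).
    * by rewrite mulr_ge0.
    * exact: lipschitz_scale be0' (@profile2_lipschitz R).
    * exact: ltW.
- by move=> w; rewrite fmin; apply: sumr_ge0 => i _; exact: phi_ge0.
- by apply: enorm_le (ltW D0) _; rewrite -nD; exact: chain_min_dist.
move=> T T1; rewrite fmin subr0 => fT; rewrite leNgt; apply/negP => Tr.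
have [Tn epsT] := hT T T1 Tr.
suff : eps < ridge phi n (chain delta v) w0 (iterate (A (3 * n)%N)
    (ridge phi n (chain delta v) w0) T) by rewrite ltNge fT.
apply: lt_le_trans epsT _; rewrite -phi0.
apply: chain_gap => //; first exact: ltnW.
by move=> i; apply: vq.
Qed.
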